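(* Let $\mathbf{G}\subseteq \mathrm{GL}_n(\mathbb{C})$ be a simple and simply-connected Chevalley group. Let $P_1,\dots,P_s$ be polynomials with integer coefficients in the variables $x_{ij}$ ($1\le i,j\le n$), and let $\tilde{\mathbf{S}}=\{(x_{ij})\in\mathbf{G}: P_1(x_{ij})=\cdots=P_s(x_{ij})=0\}$ be the affine subscheme of $\mathbf{G}$ they define. Assume that the identity matrix does not lie in $\tilde{\mathbf{S}}$, and that $\tilde{\mathbf{S}}$ is geometrically irreducible over the generic fiber. Then there exists a constant $C=C(\mathbf{G},\tilde{\mathbf{S}})$ such that for every sufficiently large prime $p$ and every finite field $\mathbb{F}_q$ with $q=p^f$ elements, $$\omega\big(\mathscr{G}_{\mathbf{G},\mathbf{S}}(\mathbb{F}_q)\big)\le C,$$ where $\omega$ denotes the size of the largest clique and $\mathscr{G}_{\mathbf{G},\mathbf{S}}(\mathbb{F}_q)=\mathrm{Cay}\big(\mathbf{G}(\mathbb{F}_q),\ \tilde{\mathbf{S}}(\mathbb{F}_q)\cup\tilde{\mathbf{S}}(\mathbb{F}_q)^{-1}\big)$.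
   Context: A Chevalley group $\mathbf{G}\subseteq\mathrm{GL}_n$ is obtained from a simple complex Lie algebra and is viewed as a group scheme of finite type over $\mathbb{Z}$, given by finitely many polynomials with integer coefficients in the $x_{ij}$, so that for every commutative unital ring $R$ the set of common solutions over $R$ is a group $\mathbf{G}(R)$ (example: $\mathrm{SL}_n$, defined by $\det(x_{ij})-1=0$). Since $\tilde{\mathbf{S}}$ is also defined over $\mathbb{Z}$, $\tilde{\mathbf{S}}(R)$ denotes the set of elements of $\mathbf{G}(R)$ at which all $P_k$ vanish. ''Geometrically irreducible over the generic fiber'' means that the variety $\tilde{\mathbf{S}}$ over an algebraic closure of $\mathbb{Q}$ (equivalently over $\mathbb{C}$) is irreducible. That the identity is not in $\tilde{\mathbf{S}}$ means that $P_k(I)\neq 0$ in $\mathbb{Z}$ for some $k$. For a group $G$ and a subset $S\subseteq G$ with $S=S^{-1}$ and $1\notin S$, the Cayley graph $\mathrm{Cay}(G,S)$ has vertex set $G$, with $g_1,g_2$ adjacent iff $g_1^{-1}g_2\in S$. *)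

(* Defs.v *)
From mathcomp Require Import all_boot all_order all_fingroup all_algebra all_field.
From mathcomp Require Import complex reals.
From mathcomp Require Import mpoly.

Set Implicit Arguments.
Unset Strict Implicit.
Unset Printing Implicit Defensive.

Import GRing.Theory.
Local Open Scope ring_scope.

(* The variable x_ij is the indeterminate of index [mxvec_index i j]. *)
Definition mxeval (n : nat) (R : comNzRingType) (P : {mpoly int[n * n]})
    (A : 'M[R]_n) : R :=
  mmap intr (fun k => mxvec A 0 k) P.

Definition points (n : nat) (E : seq {mpoly int[n * n]}) (R : comNzRingType)
    (A : 'M[R]_n) : bool :=
  all (fun P => mxeval P A == 0) E.

Definition in_ideal (n : nat) (E : seq {mpoly int[n * n]})
    (P : {mpoly int[n * n]}) : Prop :=
  exists c : 'I_(size E) -> {mpoly int[n * n]},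
    P = \sum_(i < size E) c i * E`_i.

Section LinearLie.

Variables (K : fieldType) (n : nat).
Implicit Types (A B : 'M[K]_n) (L H I : {vspace 'M[K]_n}).

Definition lie A B : 'M[K]_n := A *m B - B *m A.

Definition lie_subalgebra L : Prop :=
  forall A B, A \in L -> B \in L -> lie A B \in L.

Definition lie_ideal L I : Prop :=
  (I <= L)%VS /\ (forall A B, A \in L -> B \in I -> lie A B \in I).

Definition lie_simple L : Prop :=
  [/\ lie_subalgebra L,
      exists A B, [/\ A \in L, B \in L & lie A B != 0]
    & forall I, lie_ideal L I -> I = 0%VS \/ I = L].

(* ad(A_1) ... ad(A_m) = 0 on L for some m and all A_1, ..., A_m in L. *)
Definition lie_nilpotent L : Prop :=
  exists m : nat, forall (s : m.-tuple 'M[K]_n) B,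
    {subset s <= L} -> B \in L -> foldr lie B s = 0.

Definition cartan_subalgebra L H : Prop :=
  [/\ (H <= L)%VS, lie_subalgebra H, lie_nilpotent H
    & forall A, A \in L -> (forall B, B \in H -> lie A B \in H) -> A \in H].

Section Cartan.

Variables L H : {vspace 'M[K]_n}.

Definition dual_cartan := 'Hom(subvs_of H, K^o).
Implicit Types (a b mu la : dual_cartan) (X : dual_cartan -> 'M[K]_n).

Definition root_vector a A : Prop :=
  A \in L /\ (forall h : subvs_of H, lie (vsval h) A = (a h : K) *: A).

Definition is_root a : Prop :=
  a != 0 /\ (exists2 A, A != 0 & root_vector a A).

(* The element [X_a, X_{-a}] of H; [vsproj] is only used on elements of H. *)
Definition coroot X a : subvs_of H := vsproj H (lie (X a) (X (- a))).

(* A Chevalley basis is determined by its root vectors [X a], the remaining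
   elements being the coroots of the simple roots.  The values of [X] outside
   the roots are irrelevant. *)
Definition chevalley_basis X : Prop :=
  (forall a, is_root a ->
     [/\ root_vector a (X a),
         lie (X a) (X (- a)) \in H
       & (a (coroot X a) : K) = 2%:R]) /\
  (forall a b, is_root a -> is_root b -> is_root (a + b) ->
     exists2 c : K, lie (X a) (X b) = c *: X (a + b)
                  & lie (X (- a)) (X (- b)) = - c *: X (- (a + b))).

(* The lattice Z^n in K^n is stable under all divided powers X_a^m / m!,
   that is, under the Kostant Z-form of the enveloping algebra. *)
Definition admissible_lattice X : Prop :=
  forall a, is_root a -> forall m : nat,
    exists B : 'M[int]_n, X a ^+ m = m`!%:R *: map_mx intr B.

Definition is_weight mu : Prop :=
  exists2 v : 'cV[K]_n, v != 0 &
    forall h : subvs_of H, vsval h *m v = (mu h : K) *: v.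

Definition integral_weight X la : Prop :=
  forall a, is_root a -> exists z : int, (la (coroot X a) : K) = z%:~R.

(* The weights of the given representation span the full weight lattice. *)
Definition simply_connected X : Prop :=
  forall la, integral_weight X la ->
    exists (m : nat) (s : m.-tuple dual_cartan),
      (forall mu, mu \in tval s -> is_weight mu) /\ inIntSpan s la.

(* exp (t A); the series stops before n, for A nilpotent of size n. *)
Definition exp_nilp (t : K) A : 'M[K]_n :=
  \sum_(m < n) (t ^+ m / m`!%:R) *: A ^+ m.

(* The group generated by the exp (t X_a); since exp (t X_a)^-1 = exp (- t X_a),
   it consists of the finite products of these matrices. *)
Inductive chevalley_group X : 'M[K]_n -> Prop :=
| chevalley_one : chevalley_group X 1%:M
| chevalley_mul a t g : is_root a -> chevalley_group X g ->
    chevalley_group X (exp_nilp t (X a) *m g).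

End Cartan.

End LinearLie.

(** [E] defines a simple and simply-connected Chevalley group scheme in GL_n.

    A simple Lie algebra over C with a faithful representation on C^n is given
    by its image [L], and the coordinates x_ij are relative to a basis of an
    admissible lattice.  Following Chevalley, the coordinate ring over Z is the
    image of Z[x_ij] in the ring of functions on the complex group, i.e. [E]
    generates the ideal of integral polynomials vanishing on that group.  The
    complex group consists of matrices of determinant 1, so that all the points
    of the scheme are invertible matrices. *)
Definition simple_simply_connected_chevalley (R : realType) (n : nat)
    (E : seq {mpoly int[n * n]}) : Prop :=
  exists (L H : {vspace 'M[complex R]_n}) (X : dual_cartan H -> 'M[complex R]_n),
    [/\ lie_simple L, cartan_subalgebra L H & chevalley_basis L X] /\
    [/\ admissible_lattice L X, simply_connected L X
      & forall P : {mpoly int[n * n]},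
          in_ideal E P <->
          (forall g, chevalley_group L X g -> mxeval P g = 0)].

Section Zariski.

Variables (K : comNzRingType) (n : nat).
Implicit Types S Z : 'M[K]_n -> Prop.

Definition zariski_closed Z : Prop :=
  exists E : {mpoly K[n * n]} -> Prop,
    forall A, Z A <-> (forall P, E P -> P.@[fun k => mxvec A 0 k] = 0).

Definition zariski_irreducible S : Prop :=
  (exists A, S A) /\
  (forall Z1 Z2, zariski_closed Z1 -> zariski_closed Z2 ->
     (forall A, S A -> Z1 A \/ Z2 A) ->
     (forall A, S A -> Z1 A) \/ (forall A, S A -> Z2 A)).

End Zariski.

(* [algC] is an algebraic closure of Q. *)
Definition geometrically_irreducible (n : nat) (E : seq {mpoly int[n * n]}) :=
  zariski_irreducible (fun A : 'M[algC]_n => points E A).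

Definition cayley (gT : finGroupType) (G S : {set gT}) : rel gT :=
  fun g1 g2 => [&& g1 \in G, g2 \in G & (g1^-1 * g2)%g \in S].

Definition clique (T : finType) (V : {set T}) (e : rel T) (A : {set T}) : bool :=
  (A \subset V) && [forall x in A, forall y in A, (x != y) ==> e x y].

Definition clique_number (T : finType) (V : {set T}) (e : rel T) : nat :=
  \max_(A : {set T} | clique V e A) #|A|.

Definition GLpoints (n : nat) (E : seq {mpoly int[n.+1 * n.+1]})
    (F : finFieldType) : {set {'GL_n.+1[F]}} :=
  [set g : {'GL_n.+1[F]} | points E (val g : 'M[F]_n.+1)].

(* The closed subscheme of (the scheme defined by) [E] given by the additional
   equations [Ps] is defined by [E ++ Ps]. *)
Definition omega (n : nat) (E Ps : seq {mpoly int[n.+1 * n.+1]})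
    (F : finFieldType) : nat :=
  let G := GLpoints E F in
  let S := GLpoints (E ++ Ps) F in
  clique_number G (cayley G (S :|: S^-1)%g).

(* Main.v *)
Require Import Defs.
From mathcomp Require Import all_boot all_order all_fingroup all_algebra all_field.
From mathcomp Require Import complex reals.
From mathcomp Require Import mpoly.
Local Open Scope ring_scope.

(** Pick [P] among the equations with [P(I) <> 0].  For [g], [h] in a clique,
    [Q(g, h) = P(g^-1 h) P(h^-1 g)] vanishes if [g <> h], and equals [P(I)^2],
    which is nonzero in characteristic [p > |P(I)|], if [g = h].  So the matrix
    of [Q] on a clique is scalar and invertible, and its rank is the size of the
    clique.  On the other hand [Q(g, h)] is a sum of products of a function of
    [g] by a function of [h], where the number of terms depends only on [P];
    this bounds the rank. *)

Import GRing.Theory.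

(* The functions are families over all rings [K], so that the number [D] of
   terms is uniform in [K]. *)
Definition separable (I : comNzRingType -> Type)
    (f : forall K : comNzRingType, I K -> I K -> K) : Prop :=
  exists D : nat, forall K, exists a b : 'I_D -> I K -> K,
    forall x y, f K x y = \sum_(i < D) a i x * b i y.

Section Separable.

Variable I : comNzRingType -> Type.
Implicit Types f g : forall K : comNzRingType, I K -> I K -> K.

Lemma separable_eq f g :
  (forall K x y, f K x y = g K x y) -> separable I f -> separable I g.
Proof.
move=> fg [D fD]; exists D => K; have [a [b abE]] := fD K.
by exists a, b => x y; rewrite -fg.
Qed.

Lemma separable_swap f :
  separable I f -> separable I (fun K x y => f K y x).
Proof.
move=> [D fD]; exists D => K; have [a [b abE]] := fD K.
by exists b, a => x y; rewrite abE; apply: eq_bigr => i _; rewrite mulrC.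
Qed.

Lemma separable_mull (u v : forall K : comNzRingType, I K -> K) :
  separable I (fun K x y => u K x * v K y).
Proof.
by exists 1%N => K; exists (fun _ => u K), (fun _ => v K) => x y; rewrite big_ord1.
Qed.

Lemma separable_const (z : int) : separable I (fun K _ _ => z%:~R).
Proof.
apply: separable_eq (separable_mull (fun _ _ => z%:~R) (fun _ _ => 1)) => K x y.
by rewrite mulr1.
Qed.

Lemma separableD f g : separable I f -> separable I g ->
  separable I (fun K x y => f K x y + g K x y).
Proof.
move=> [D fD] [D' gD]; exists (D + D')%N => K.
have [[a [b fE]] [a' [b' gE]]] := (fD K, gD K).
pose glue (u : 'I_D -> I K -> K) u' (i : 'I_(D + D')) :=
  match split i with inl j => u j | inr j => u' j end.
exists (glue a a'), (glue b b') => x y; rewrite fE gE big_split_ord /glue.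
by congr (_ + _); apply: eq_bigr => i _;
  [rewrite (unsplitK (inl i)) | rewrite (unsplitK (inr i))].
Qed.

(** Expanding the product of the two sums gives one term for each pair of indices, enumerated here
    by [enum_val]. *)
Lemma separableM f g : separable I f -> separable I g ->
  separable I (fun K x y => f K x y * g K x y).
Proof.
move=> [D fD] [D' gD]; exists #|{: 'I_D * 'I_D'}| => K.
have [[a [b fE]] [a' [b' gE]]] := (fD K, gD K).
pose prod (u : 'I_D -> I K -> K) (u' : 'I_D' -> I K -> K)
  (i : 'I_#|{: 'I_D * 'I_D'}|) x :=
  u (enum_val i).1 x * u' (enum_val i).2 x.
exists (prod a a'), (prod b b') => x y.
rewrite fE gE big_distrlr pair_bigA (reindex _ (onW_bij _ (@enum_val_bij _))) /=.
by apply: eq_bigr => i _; rewrite mulrACA.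
Qed.

Lemma separable_sum (T : Type) (s : seq T)
    (f : T -> forall K : comNzRingType, I K -> I K -> K) :
  (forall t, separable I (f t)) ->
  separable I (fun K x y => \sum_(t <- s) f t K x y).
Proof.
move=> fS; elim: s => [|t s IHs].
  by apply: separable_eq (separable_const 0) => K x y; rewrite big_nil.
by apply: separable_eq (separableD _ _ (fS t) IHs) => K x y; rewrite big_cons.
Qed.

Lemma separable_prod (T : Type) (s : seq T)
    (f : T -> forall K : comNzRingType, I K -> I K -> K) :
  (forall t, separable I (f t)) ->
  separable I (fun K x y => \prod_(t <- s) f t K x y).
Proof.
move=> fS; elim: s => [|t s IHs].
  by apply: separable_eq (separable_const 1) => K x y; rewrite big_nil.
by apply: separable_eq (separableM _ _ (fS t) IHs) => K x y; rewrite big_cons.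
Qed.

Lemma separable_exp f m :
  separable I f -> separable I (fun K x y => f K x y ^+ m).
Proof.
move=> fS; elim: m => [|m IHm]; first exact: (separable_const 1).
by apply: separable_eq (separableM _ _ fS IHm) => K x y; rewrite exprS.
Qed.

(** Entry [(i, j)] of the product is the sum over [l] of [u i l * v l j], hence separable; [P]
    combines these entries by sums and products whose number is fixed by [P] alone. *)
Lemma separable_mxeval_mul n (P : {mpoly int[n * n]})
    (u v : forall K : comNzRingType, I K -> 'M[K]_n) :
  separable I (fun K x y => mxeval P (u K x *m v K y)).
Proof.
rewrite /mxeval /mmap /mmap1.
apply: separable_sum => m; apply: separableM; first exact: separable_const.
apply: separable_prod => k; apply: separable_exp.
case/mxvec_indexP: k => i j.
apply: separable_eq (separable_sum _ (index_enum 'I_n) _ (fun l =>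
  separable_mull (fun K x => u K x i l) (fun K y => v K y l j))) => K x y.
by rewrite mxvecE mxE.
Qed.

End Separable.

(** An invertible matrix of size [k] that factors through dimension [D] has rank [k] and rank at
    most [D]. *)
Lemma scalar_sum_mul_leq (F : fieldType) (k D : nat) (a b : 'I_D -> 'I_k -> F) c :
  c != 0 -> (forall x y, \sum_(i < D) a i x * b i y = c *+ (x == y)) ->
  (k <= D)%N.
Proof.
move=> c0 abE; pose A := \matrix_(x, i) a i x; pose B := \matrix_(i, y) b i y.
have AB : A *m B = c%:M.
  by apply/matrixP => x y; rewrite !mxE -abE; apply: eq_bigr => i _; rewrite !mxE.
have /mxrank_unit <- : A *m B \in unitmx.
  by rewrite AB unitmxE det_scalar unitfE expf_neq0.
exact: leq_trans (mxrankM_maxl A B) (rank_leq_col A).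
Qed.

Lemma mxeval_intr n (K : comNzRingType) (P : {mpoly int[n * n]}) (A : 'M[int]_n) :
  mxeval P (map_mx intr A : 'M[K]_n) = (mxeval P A)%:~R.
Proof.
rewrite /mxeval /mmap rmorph_sum; apply: eq_bigr => m _.
rewrite rmorphM /= intz /mmap1 rmorph_prod; congr (_ * _); apply: eq_bigr => k _.
by rewrite rmorphXn /= -map_mxvec mxE.
Qed.

(** Vanishing in [F] would make [p] divide the positive number [|z|], which is smaller than [p]. *)
Lemma intr_pchar_neq0 (F : fieldType) (p : nat) (z : int) :
  p \in [pchar F] -> z != 0 -> (`|z| < p)%N -> z%:~R != 0 :> F.
Proof.
move=> pF z0 zp; rewrite (intEsign z) rmorphM rmorph_sign /= mulf_neq0 ?signr_eq0 //.
by rewrite -pmulrn -(dvdn_pcharf pF) gtnNdvd // absz_gt0.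
Qed.

Theorem proposition1p7 (R : realType) (n : nat)
    (E Ps : seq {mpoly int[n.+1 * n.+1]})
    (hG : simple_simply_connected_chevalley R E)
    (h1 : exists2 P, P \in Ps & mxeval P (1%:M : 'M[int]_n.+1) <> 0)
    (hirr : geometrically_irreducible (E ++ Ps)) :
  exists C p0 : nat, forall (p f : nat) (F : finFieldType),
    prime p -> (p0 <= p)%N -> #|F| = (p ^ f)%N ->
    (omega E Ps F <= C)%N.
Proof.
have [P PPs /eqP z0] := h1; set z := mxeval P _ in z0.
(* A point is a pair of matrices, standing for [(g, g^-1)]. *)
pose I (K : comNzRingType) := ('M[K]_n.+1 * 'M[K]_n.+1)%type.
(* At [x = (g, g^-1)] and [y = (h, h^-1)] this is [P(g^-1 h)]; swapping [x] and [y] gives the other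
   factor [P(h^-1 g)]. *)
have Psep := separable_mxeval_mul I n.+1 P (fun K x => x.2) (fun K y => y.1).
have [C QC] := separableM I _ _ Psep (separable_swap I _ Psep).
(* [C] is the number of terms, obtained before any field is chosen; the threshold forces
   [p > |z|]. *)
exists C, `|z|.+1 => p f F p_pr zp cardF.
have zF := intr_pchar_neq0 F p z (card_finPcharP cardF p_pr) z0 zp.
rewrite /omega /clique_number; apply/bigmax_leqP => A /andP[_ /forallP cliqueA].
have [a [b abE]] := QC F.
pose pt (i : 'I_#|A|) : I F := let g := enum_val i in (val g, val (g^-1)%g).
apply: (scalar_sum_mul_leq F #|A| C (fun i x => a i (pt x))
  (fun i y => b i (pt y)) (z%:~R * z%:~R)); first exact: mulf_neq0.
pose Pv (g : {'GL_n.+1[F]}) := mxeval P (val g : 'M[F]_n.+1).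
have Pv1 : Pv 1%g = z%:~R by rewrite -mxeval_intr map_mx1.
move=> x y; rewrite -abE -[LHS]/(Pv ((enum_val x)^-1 * enum_val y)%g *
  Pv ((enum_val y)^-1 * enum_val x)%g).
have [<-|xy] := eqVneq x y.
  by rewrite mulVg Pv1.
have PS h : h \in GLpoints (E ++ Ps) F -> Pv h = 0.
  by rewrite inE => /allP/(_ P); rewrite mem_cat PPs orbT => /(_ isT)/eqP.
have := cliqueA (enum_val x); rewrite enum_valP => /forallP/(_ (enum_val y)).
rewrite enum_valP (inj_eq enum_val_inj) xy => /and3P[_ _].
(* Either [g^-1 h] or its inverse [h^-1 g] lies in [S], so one of the two factors vanishes. *)
rewrite inE mem_invg invMg invgK => /orP[] /PS -> ; first by rewrite mul0r.
by rewrite mulr0.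
Qed.
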